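(* If $\Delta\subset M_{\mathbb R}$ is a $\mathbb{Q}$-reflexive polytope, then $\Delta^*\subset N_{\mathbb R}$ is a canonical Fano polytope (with respect to the lattice $N$).
   Context: $M$ is a lattice of rank $d$, $N=\mathrm{Hom}(M,\mathbb Z)$ its dual lattice with the natural pairing $\langle\cdot,\cdot\rangle$, $M_{\mathbb R}=M\otimes\mathbb R$, $N_{\mathbb R}=N\otimes\mathbb R$. For a subset $P\subset M_{\mathbb R}$, $P^*=\{n\in N_{\mathbb R}\mid \langle m,n\rangle\ge-1\ \forall m\in P\}$ (and symmetrically for subsets of $N_{\mathbb R}$). A $d$-dimensional polytope $\Delta\subset M_{\mathbb R}$ is $\mathbb{Q}$-reflexive (with respect to $M$) if $0\in\mathrm{int}(\Delta)$ and $\mathrm{Conv}\big((\mathrm{Conv}(\Delta\cap M))^*\cap N\big)=\Delta^*$. A $d$-dimensional lattice polytope $P\subset N_{\mathbb R}$ (vertices in $N$) is a canonical Fano polytope if $\mathrm{int}(P)\cap N=\{0\}$. *)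

(* Defs.v *)
From HB Require Import structures.
From mathcomp Require Import all_boot all_order all_algebra.
From mathcomp Require Import all_classical all_reals all_analysis.

Set Implicit Arguments.
Unset Strict Implicit.
Unset Printing Implicit Defensive.

Import Order.TTheory GRing.Theory Num.Theory.
Import numFieldNormedType.Exports.

Local Open Scope classical_set_scope.
Local Open Scope ring_scope.

(* A lattice M of rank d is given inside M_R: after the choice of an arbitrary
   linear isomorphism of M_R with R^d (row vectors), it is the Z-span of some
   basis of R^d, not necessarily the standard one. N_R is the space of linear
   forms on M_R, written as column vectors, so that the natural pairing is the
   matrix product, and N = Hom(M, Z) is the set of linear forms that take
   integer values on M. *)

Definition pairing (R : realType) (d : nat) (m : 'rV[R]_d) (n : 'cV[R]_d) : R :=
  (m *m n) ord0 ord0.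

Definition is_lattice (R : realType) (d : nat) (M : set 'rV[R]_d) : Prop :=
  exists2 B : 'M[R]_d, B \in unitmx &
    M = [set map_mx intr z *m B | z in [set: 'rV[int]_d]].

Definition dual_lattice (R : realType) (d : nat) (M : set 'rV[R]_d) :
    set 'cV[R]_d :=
  [set n | forall m, M m -> pairing m n \is a Num.int].

Definition polar (R : realType) (d : nat) (P : set 'rV[R]_d) : set 'cV[R]_d :=
  [set n | forall m, P m -> -1 <= pairing m n].

Definition conv_hull (R : realType) (V : normedModType R) (A : set V) : set V :=
  smallest (@convex_set R V) A.

Definition affine_hull (R : realType) (V : normedModType R) (A : set V) :
    set V :=
  [set x | exists (k : nat) (p : 'I_k -> V) (w : 'I_k -> R),
     [/\ forall i, A (p i), \sum_i w i = 1 & x = \sum_i w i *: p i]].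

Definition polytope (R : realType) (V : normedModType R) (P : set V) : Prop :=
  exists2 S : set V, finite_set S & P = conv_hull S.

(* The ambient space has dimension d, so a polytope in it is d-dimensional
   when its affine hull is everything. *)
Definition full_dim (R : realType) (V : normedModType R) (P : set V) : Prop :=
  affine_hull P = setT.

Definition vertex (R : realType) (V : normedModType R) (P : set V) (v : V) :
    Prop :=
  P v /\ forall (x y : V) (t : R), P x -> P y -> 0 < t < 1 ->
    v = t *: x + (1 - t) *: y -> x = y.

Definition Q_reflexive (R : realType) (d : nat) (M Delta : set 'rV[R]_d) :
    Prop :=
  [/\ polytope Delta, full_dim Delta, interior Delta 0 &
      conv_hull (polar (conv_hull (Delta `&` M)) `&` dual_lattice M)
        = polar Delta].

Definition canonical_Fano (R : realType) (d : nat) (N P : set 'cV[R]_d) :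
    Prop :=
  [/\ polytope P, full_dim P, (forall v, vertex P v -> N v) &
      interior P `&` N = [set 0]].

(* Main.v *)
Require Import Defs.
From HB Require Import structures.
From mathcomp Require Import all_boot all_order all_algebra.
From mathcomp Require Import all_classical all_reals all_analysis.
From mathcomp Require Import ring lra.

(** Write [A] for the set of points of [N] in the polar of
    [conv_hull (Delta `&` M)], so that the hypothesis reads
    [conv_hull A = polar Delta].

    Since [0] is interior to [Delta], the polar of [Delta] is bounded
    ([bounded_polar]), and a bounded set contains finitely many points of a
    lattice ([finite_bounded_dual_lattice]).  Hence [A] is finite, [polar Delta]
    is a polytope, and its vertices lie in [A], hence in [N]
    ([vertex_conv_hull]).  Since [Delta] is bounded, [0] is interior to
    [polar Delta] ([interior_polar]), which also gives full dimension.

    The remaining point is that [0] is the only interior lattice point.  Let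
    [n] be an interior point of [polar Delta] that lies in [N].  On
    [Delta `&` M] the form [n] takes values that are integers, because [n] is
    in [N], and that are greater than [-1], because [n] is interior
    ([pairing_gtN1_interior_polar]).  So these values are nonnegative, and then
    every multiple [k n] satisfies the inequalities defining [A].  Thus the
    whole ray of multiples of [n] lies in the bounded set [polar Delta], which
    forces [n = 0]. *)

Set Implicit Arguments.
Unset Strict Implicit.
Unset Printing Implicit Defensive.

Import Order.TTheory GRing.Theory Num.Theory.
Import numFieldNormedType.Exports.

Local Open Scope classical_set_scope.
Local Open Scope ring_scope.

Lemma mx_entry_le_norm (R : realType) (m n : nat) (A : 'M[R]_(m, n)) i j :
  `|A i j| <= `|A|.
Proof.
rewrite [leRHS]/Num.norm/= mx_normrE.
exact: (le_bigmax _ (fun ij : 'I_m * 'I_n => `|A ij.1 ij.2|) (i, j)).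
Qed.

Lemma mx_norm_le (R : realType) (m n : nat) (A : 'M[R]_(m, n)) (c : R) :
  0 <= c -> (forall i j, `|A i j| <= c) -> `|A| <= c.
Proof.
move=> c0 Ac; rewrite [leLHS]/Num.norm/= mx_normrE.
by apply: bigmax_le => // -[i j] _; exact: Ac.
Qed.

Lemma bounded_setP (R : realType) (V : normedModType R) (A : set V) :
  bounded_set A <-> exists2 C, 0 < C & forall x, A x -> `|x| <= C.
Proof.
split=> [/pinfty_ex_gt0[C C0 AC]|[C C0 AC]]; first by exists C.
exists C; split=> [|D CD x Ax]; first exact: num_real.
exact: le_trans (AC x Ax) (ltW CD).
Qed.

Lemma pairingE (R : realType) (d : nat) (m : 'rV[R]_d) (n : 'cV[R]_d) :
  pairing m n = \sum_i m ord0 i * n i ord0.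
Proof. by rewrite /pairing mxE. Qed.

Lemma pairingZr (R : realType) (d : nat) (m : 'rV[R]_d) (n : 'cV[R]_d) (c : R) :
  pairing m (c *: n) = c * pairing m n.
Proof. by rewrite /pairing -scalemxAr mxE. Qed.

Lemma pairingZl (R : realType) (d : nat) (m : 'rV[R]_d) (n : 'cV[R]_d) (c : R) :
  pairing (c *: m) n = c * pairing m n.
Proof. by rewrite /pairing -scalemxAl mxE. Qed.

Lemma pairingDl (R : realType) (d : nat) (m m' : 'rV[R]_d) (n : 'cV[R]_d) :
  pairing (m + m') n = pairing m n + pairing m' n.
Proof. by rewrite /pairing mulmxDl mxE. Qed.

(** Each [n] cuts out a half-space [-1 <= pairing m n], which is convex, so
    as soon as it contains [P] it contains the hull of [P]. *)
Lemma polar_conv_hull (R : realType) (d : nat) (P : set 'rV[R]_d) :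
  polar (conv_hull P) = polar P.
Proof.
apply/seteqP; split=> n nP m.
  by move=> Pm; apply: nP; exact: sub_gen_smallest.
move: m; apply: (@smallest_sub _ _ _ [set m | -1 <= pairing m n]) => //.
move=> x y t; rewrite !inE /= => xn yn.
have t0 : 0 <= t%:num by [].
have t1 : 0 <= 1 - t%:num by rewrite subr_ge0.
by rewrite pairingDl !pairingZl /unstable.onem; nra.
Qed.

Lemma norm_pairing_le (R : realType) (d : nat) (m : 'rV[R]_d) (n : 'cV[R]_d) :
  `|pairing m n| <= d%:R * (`|m| * `|n|).
Proof.
rewrite pairingE (le_trans (ler_norm_sum _ _ _))//.
rewrite -[X in X%:R * _](card_ord d) mulr_natl -sumr_const ler_sum// => i _.
by rewrite normrM ler_pM// mx_entry_le_norm.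
Qed.

(** A closed ball that contains [S] is convex, so it contains the hull. *)
Lemma bounded_conv_hull (R : realType) (V : normedModType R) (S : set V) :
  bounded_set S -> bounded_set (conv_hull S).
Proof.
move=> /bounded_setP[C C0 SC]; apply/bounded_setP; exists C => //.
apply: smallest_sub => // x y t; rewrite !inE /= => xC yC.
have t0 : 0 <= t%:num by [].
have t1 : 0 <= 1 - t%:num by rewrite subr_ge0.
rewrite (le_trans (ler_normD _ _))// !normrZ /unstable.onem.
rewrite (ger0_norm t0) (ger0_norm t1); nra.
Qed.

Lemma bounded_polytope (R : realType) (V : normedModType R) (P : set V) :
  polytope P -> bounded_set P.
Proof.
by move=> [S Sfin ->]; exact/bounded_conv_hull/compact_bounded/finite_compact.
Qed.

Lemma convex_conv_hull (R : realType) (V : normedModType R) (A : set V) :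
  convex_set (conv_hull A).
Proof.
move=> x y t; rewrite !inE => hx hy B [cB AB].
by move: (cB x y t); rewrite !inE; apply; [apply: hx|apply: hy].
Qed.

(** A vertex is not in the interior of a segment of the hull, so removing it
    leaves a convex set.  If [v] were not in [A], that smaller convex set would
    still contain [A], against the minimality of the hull. *)
Lemma vertex_conv_hull (R : realType) (V : normedModType R) (A : set V) v :
  vertex (conv_hull A) v -> A v.
Proof.
move=> [hv ext]; apply: contrapT => nAv.
suff /(_ v hv)[_ /(_ erefl)] : conv_hull A `<=` conv_hull A `\` [set v] by [].
apply: smallest_sub; last first.
  move=> x Ax; split; first exact: sub_gen_smallest.
  by move=> xv; apply: nAv; rewrite -xv.
apply/convex_setW => x y; rewrite !inE => -[xA xv] [yA yv] t t0 t1.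
rewrite inE; split.
  by rewrite -in_setE; apply: convex_conv_hull; rewrite inE.
move=> tv; apply: xv => /=.
have xy : x = y by apply: (ext x y t%:num) => //; rewrite t0.
by rewrite -tv xy convmm.
Qed.

(** Any [x] lies on the line through [0] and a small multiple of [x], both of
    which are in [P]. *)
Lemma full_dim_interior0 (R : realType) (V : normedModType R) (P : set V) :
  interior P 0 -> full_dim P.
Proof.
move=> /nbhs_normP[e /= e0 Pe]; apply/seteqP; split=> // x _.
(* The norm of t^-1 *: x is e * |x| / (|x| + 1), which is less than e. *)
pose t := (`|x| + 1) / e.
have t0 : 0 < t by rewrite divr_gt0// ltr_pwDr.
exists 2, (fun i => if i == ord0 then t^-1 *: x else 0),
  (fun i => if i == ord0 then t else 1 - t).
split=> [i||].
- apply: Pe => /=; rewrite sub0r normrN; case: ifP => _; last by rewrite normr0.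
  rewrite normrZ gtr0_norm ?invr_gt0// /t invf_div mulrAC ltr_pdivrMr ?ltr_pwDr//.
  by rewrite ltr_pM2l// ltrDl.
- by rewrite !big_ord_recl big_ord0 /=; ring.
- rewrite !big_ord_recl big_ord0 /= scalerA mulfV ?gt_eqF//.
  by rewrite scale1r scaler0 !addr0.
Qed.

(** If the points of [P] have norm at most [C], the pairing of such a point with
    [n] is at most [d * C * `|n|] in absolute value, which is less than [1] for
    [n] small. *)
Lemma interior_polar (R : realType) (d : nat) (P : set 'rV[R]_d) :
  bounded_set P -> interior (polar P) 0.
Proof.
move=> /bounded_setP[C C0 PC].
have D0 : 0 < d%:R * C + 1 by rewrite ltr_wpDl// mulr_ge0// ltW.
apply: (nbhs_normP (0 : 'cV[R]_d) (polar P)).2.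
exists (d%:R * C + 1)^-1 => /=; first by rewrite invr_gt0.
move=> n /=; rewrite sub0r normrN -div1r ltr_pdivlMr// => nD m Pm.
rewrite lerNl; apply: le_trans (ler_norm _) _; rewrite normrN.
apply: le_trans (norm_pairing_le _ _) _.
have := PC m Pm; have : 0 <= `|m| by []; have : 0 <= `|n| by [].
move=> n0 m0 mC.
have : d%:R * (`|m| * `|n|) <= d%:R * (C * `|n|).
  by rewrite ler_wpM2l// ler_wpM2r.
nra.
Qed.

(** [P] contains a ball of radius [e]; testing the inequalities of the polar on
    the points [e / 2] and [- e / 2] of each coordinate axis bounds every
    coordinate of [n] by [2 / e]. *)
Lemma bounded_polar (R : realType) (d : nat) (P : set 'rV[R]_d) :
  interior P 0 -> bounded_set (polar P).
Proof.
move=> /nbhs_normP[e /= e0 Pe]; apply/bounded_setP.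
exists (2 / e); first exact: divr_gt0.
move=> n nP; apply: mx_norm_le => [|i j]; first exact/ltW/divr_gt0.
rewrite (ord1 j).
have pi c : `|c| < e -> -1 <= c * n i ord0.
  move=> ce; have /nP : P (c *: delta_mx ord0 i).
    apply: Pe => /=; rewrite sub0r normrN normrZ (le_lt_trans _ ce)//.
    rewrite ler_piMr// mx_norm_le// => k l; rewrite mxE.
    by case: (_ && _); rewrite ?normr1 ?normr0.
  rewrite pairingE (bigD1 i)//= big1 ?addr0 => [|k /negPf ki]; last first.
    by rewrite !mxE ki andbF mulr0 mul0r.
  by rewrite !mxE !eqxx mulr1.
have e2 : `|e / 2| < e by rewrite gtr0_norm ?divr_gt0//; lra.
have := pi _ e2; have := pi (- (e / 2)); rewrite normrN => /(_ e2).
rewrite ler_norml => h1 h2; rewrite -[- (2 / e)]mulNr ler_pdivrMr// ler_pdivlMr//.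
by apply/andP; split; lra.
Qed.

(** Adding [K] to each coordinate turns such vectors into vectors of naturals
    at most [2 K], which are finitely many. *)
Lemma finite_bounded_int (R : realType) (d K : nat) :
  finite_set [set v : 'cV[R]_d |
    forall i, v i ord0 \is a Num.int /\ `|v i ord0| <= K%:R].
Proof.
pose f (g : {ffun 'I_d -> 'I_(K + K).+1}) : 'cV[R]_d :=
  \col_i ((g i)%:R - K%:R).
apply: sub_finite_set (finite_image f (@finite_finset _ setT)) => v hv.
have /choice[k kE] i : exists k : 'I_(K + K).+1, v i ord0 = k%:R - K%:R.
  have [vint] := hv i; rewrite ler_norml => /andP[lo hi].
  have /natrP[k kE] : v i ord0 + K%:R \is a Num.nat.
    by rewrite natrEint rpredD//= ?natr_int// -lerBlDr sub0r.
  have kK : (k < (K + K).+1)%N by rewrite ltnS -(ler_nat R) -kE natrD lerD2r.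
  by exists (Ordinal kK); rewrite /= -kE addrK.
exists (finfun k) => //; apply/matrixP => i j.
by rewrite (ord1 j) mxE ffunE -kE.
Qed.

(** In the coordinates dual to a basis of [M] (the rows of [B]), the points of
    the dual lattice become integer vectors, and bounded sets stay bounded. *)
Lemma finite_bounded_dual_lattice (R : realType) (d : nat)
    (M : set 'rV[R]_d) (A : set 'cV[R]_d) :
  is_lattice M -> bounded_set A -> finite_set (A `&` dual_lattice M).
Proof.
move=> [B Bunit ->] /bounded_setP[C C0 AC].
pose K := Num.bound (d%:R * (`|B| * C)).
have BrowE i (n : 'cV[R]_d) : (B *m n) i ord0 = pairing (row i B) n.
  by rewrite /pairing -row_mul [RHS]mxE.
apply: sub_finite_set
  (finite_image (mulmx (invmx B)) (@finite_bounded_int R d K)).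
move=> n [An Nn]; exists (B *m n); last by rewrite mulKmx.
move=> i; rewrite BrowE; split.
  apply: Nn; exists (delta_mx ord0 i) => //.
  by rewrite map_delta_mx -rowE.
apply: le_trans (ltW (archi_boundP _)); last first.
  by rewrite mulr_ge0// mulr_ge0// ltW.
apply: le_trans (norm_pairing_le _ _) _.
rewrite ler_wpM2l// ler_pM//; last exact: AC.
by apply: mx_norm_le => // k j; rewrite mxE mx_entry_le_norm.
Qed.

(** Some [(1 + t) *: n] with [t > 0] is still in the polar, so that
    [(1 + t) * pairing m n >= -1]. *)
Lemma pairing_gtN1_interior_polar (R : realType) (d : nat)
    (P : set 'rV[R]_d) m n :
  interior (polar P) n -> P m -> -1 < pairing m n.
Proof.
move=> nint Pm; have /nbhs_normP[e /= e0 eP] := nint.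
pose t := e / (`|n| + 1).
have n1 : 0 < `|n| + 1 by rewrite ltr_wpDl.
have t0 : 0 < t by rewrite divr_gt0.
have : polar P ((1 + t) *: n).
  apply: eP => /=; rewrite scalerDl scale1r opprD addNKr normrN normrZ gtr0_norm//.
  by rewrite /t mulrAC ltr_pdivrMr// ltr_pM2l// ltrDl.
move=> /(_ m Pm); rewrite pairingZr => h.
rewrite ltNge; apply/negP => le; nra.
Qed.

Theorem corollary1p17 (R : realType) (d : nat) (M : set 'rV[R]_d)
    (hM : is_lattice M) (Delta : set 'rV[R]_d) (hDelta : Q_reflexive M Delta) :
  canonical_Fano (dual_lattice M) (polar Delta).
Proof.
have [polyD _ intD hullE] := hDelta.
have bndP := bounded_polar intD.
have int0 := interior_polar (bounded_polytope polyD).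
set A := polar (conv_hull _) `&` _ in hullE.
have AP : A `<=` polar Delta by rewrite -hullE; exact: sub_gen_smallest.
split.
- exists A => //.
  apply: sub_finite_set (finite_bounded_dual_lattice hM bndP) => n An.
  by split; [exact: AP|case: An].
- exact: full_dim_interior0.
- by move=> v; rewrite -hullE => /vertex_conv_hull[].
- apply/seteqP; split=> [n [nint Nn]|_ ->]; last first.
    by split=> // m _; rewrite /pairing mulmx0 mxE.
  have pos m : (Delta `&` M) m -> 0 <= pairing m n.
    move=> [Dm Mm]; have := pairing_gtN1_interior_polar nint Dm.
    by move: (Nn m Mm) => /intrP[z ->]; rewrite -[-1]/((-1)%:~R) ltr_int ler0z.
  (* k n pairs to at least 0, hence to at least -1, with every m in Delta and M. *)
  have mulA k : A (k%:R *: n).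
    split=> [|m Mm]; last by rewrite pairingZr rpredM// ?natr_int// Nn.
    rewrite polar_conv_hull => m Dm.
    by rewrite pairingZr (le_trans (lerN10 _))// mulr_ge0// pos.
  have [C C0 PC] := (bounded_setP _).1 bndP.
  (* A multiple of n by k > C / |n| has norm greater than C. *)
  apply: contrapT => /eqP n0.
  have := PC _ (AP _ (mulA (Num.bound (C / `|n|)))).
  rewrite normrZ normr_nat leNgt -ltr_pdivrMr ?normr_gt0// archi_boundP//.
  by rewrite divr_ge0// ltW.
Qed.
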